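(* Let $M$ be a monoid, $A$ a submonoid of $M$, $\varphi\colon A\to M$ a homomorphism, and let $L=\langle M,t\mid at=t\varphi(a),\ a\in A\rangle$ be the Otto-Pride extension. Let $T$ be the graph with vertex set $V=L/M$ and edge set $E=L/A$, where for each $x\in L$ the edge $[x]_A$ connects the vertex $[x]_M$ to the vertex $[xt]_M$. Then $T$ is a tree.
   Context: The Otto-Pride extension $L$ is the quotient of the monoid free product $M\ast\{t\}^*$ (with $\{t\}^*$ the free monoid on $t$) by the smallest congruence such that $at=t\varphi(a)$ for all $a\in A$. For $K\in\{M,A\}$, $K$ acts on the right of $L$ by right multiplication (via the canonical map to $L$, where $A$ maps via the inclusion $A\subseteq M$). $L/K$ denotes the quotient of $L$ by the equivalence relation generated by $x\sim xk$ for $x\in L$, $k\in K$, and $[x]_K$ denotes the class of $x$. The incidence in $T$ is well defined. *)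

(* Defs.v *)
From HB Require Import structures.
From mathcomp Require Import all_boot.
From mathcomp Require Import boolp.
From Stdlib Require Import Relation_Operators.

Set Implicit Arguments.
Unset Strict Implicit.
Unset Printing Implicit Defensive.

Local Open Scope group_scope.
Local Open Scope quotient_scope.

(* Multigraphs: loops and parallel edges are allowed, and the order of the two
   endpoints of an edge is irrelevant to the notions below, because an edge may
   be traversed in either direction. *)

Record multigraph := Multigraph {
  vertex : eqType;
  edge : eqType;
  endpoint0 : edge -> vertex;
  endpoint1 : edge -> vertex
}.

Section Multigraph.
Variable G : multigraph.

(* (e, true) is e traversed from endpoint0 to endpoint1, (e, false) is e
   traversed backwards. *)
Definition dart : Type := (edge G * bool)%type.

Definition origin (d : dart) : vertex G :=
  if d.2 then endpoint0 d.1 else endpoint1 d.1.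

Definition terminus (d : dart) : vertex G :=
  if d.2 then endpoint1 d.1 else endpoint0 d.1.

Fixpoint is_walk (x : vertex G) (p : seq dart) (y : vertex G) : bool :=
  if p is d :: p' then (origin d == x) && is_walk (terminus d) p' y
  else x == y.

(* A loop is a cycle of length 1 and two parallel edges form a cycle of
   length 2; distinctness of the edges rules out e followed by its reverse. *)
Definition is_cycle (p : seq dart) : Prop :=
  [/\ p <> [::], exists x, is_walk x p x,
      uniq [seq origin d | d <- p] & uniq [seq d.1 | d <- p]].

Definition is_connected : Prop :=
  inhabited (vertex G) /\ forall x y : vertex G, exists p, is_walk x p y.

Definition is_tree : Prop := is_connected /\ forall p, ~ is_cycle p.

End Multigraph.

Definition free_monoid (X : Type) : Type := seq X.

HB.instance Definition _ (X : choiceType) := Choice.copy (free_monoid X) (seq X).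
HB.instance Definition _ (X : choiceType) :=
  isMonoid.Build (free_monoid X) (@catA X) (@cat0s X) (@cats0 X).

Definition letter (X : choiceType) (x : X) : free_monoid X := [:: x].

Section CongruenceQuotient.
Variables (G : monoidType) (R : G -> G -> Prop).

Inductive congr_closure : G -> G -> Prop :=
| congr_base x y : R x y -> congr_closure x y
| congr_refl x : congr_closure x x
| congr_sym x y : congr_closure x y -> congr_closure y x
| congr_trans x y z :
    congr_closure x y -> congr_closure y z -> congr_closure x z
| congr_mul x x' y y' :
    congr_closure x x' -> congr_closure y y' -> congr_closure (x * y) (x' * y').

Definition congr_rel : rel G := fun x y => `[< congr_closure x y >].

Lemma congr_rel_refl : reflexive congr_rel.
Proof. by move=> x; apply/asboolP; apply: congr_refl. Qed.

Lemma congr_rel_sym : symmetric congr_rel.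
Proof. by move=> x y; apply/asboolP/asboolP; apply: congr_sym. Qed.

Lemma congr_rel_trans : transitive congr_rel.
Proof.
by move=> y x z /asboolP xy /asboolP yz; apply/asboolP; apply: congr_trans xy yz.
Qed.

Canonical congr_equiv :=
  EquivRel congr_rel congr_rel_refl congr_rel_sym congr_rel_trans.

Definition congr_quot : Type := {eq_quot congr_equiv}.
HB.instance Definition _ := Choice.on congr_quot.
HB.instance Definition _ := Quotient.on congr_quot.
HB.instance Definition _ := EqQuotient.on congr_quot.

Lemma congr_quotP (x y : G) :
  \pi_congr_quot x = \pi_congr_quot y <-> congr_closure x y.
Proof.
split; first by move/eqquotP/asboolP.
by move=> xy; apply/eqquotP/asboolP.
Qed.

Definition congr_quot_mul (x y : congr_quot) : congr_quot :=
  \pi_congr_quot (repr x * repr y).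

Lemma pi_congr_mul (x y : G) :
  congr_quot_mul (\pi x) (\pi y) = \pi_congr_quot (x * y).
Proof.
by apply/congr_quotP/congr_mul; apply/congr_quotP; rewrite reprK.
Qed.

Lemma congr_quot_mulA : associative congr_quot_mul.
Proof.
by elim/quotW=> x; elim/quotW=> y; elim/quotW=> z; rewrite !pi_congr_mul mulgA.
Qed.

Lemma congr_quot_mul1g : left_id (\pi_congr_quot 1) congr_quot_mul.
Proof. by elim/quotW=> x; rewrite pi_congr_mul mul1g. Qed.

Lemma congr_quot_mulg1 : right_id (\pi_congr_quot 1) congr_quot_mul.
Proof. by elim/quotW=> x; rewrite pi_congr_mul mulg1. Qed.

HB.instance Definition _ :=
  isMonoid.Build congr_quot congr_quot_mulA congr_quot_mul1g congr_quot_mulg1.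

Lemma pi_congrM (x y : G) : \pi_congr_quot (x * y) = \pi_congr_quot x * \pi_congr_quot y.
Proof. by rewrite -pi_congr_mul. Qed.

End CongruenceQuotient.

Section FreeProduct.
Variables M N : monoidType.

Local Notation word := (free_monoid (M + N)%type).
Local Notation inM m := (letter (inl m) : word).
Local Notation inN n := (letter (inr n) : word).

Inductive free_product_rel : word -> word -> Prop :=
| free_product_mull m m' : free_product_rel (inM m * inM m') (inM (m * m'))
| free_product_onel : free_product_rel (inM 1) 1
| free_product_mulr n n' : free_product_rel (inN n * inN n') (inN (n * n'))
| free_product_oner : free_product_rel (inN 1) 1.

Definition free_product : monoidType := congr_quot free_product_rel.

Definition free_product_inl (m : M) : free_product :=
  \pi_(congr_quot free_product_rel) (inM m).
Definition free_product_inr (n : N) : free_product :=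
  \pi_(congr_quot free_product_rel) (inN n).

Lemma free_product_inlM m m' :
  free_product_inl (m * m') = free_product_inl m * free_product_inl m'.
Proof.
rewrite /free_product_inl -pi_congrM; apply/congr_quotP/congr_sym/congr_base.
exact: free_product_mull.
Qed.

Lemma free_product_inl1 : free_product_inl 1 = 1.
Proof. by apply/congr_quotP/congr_base; apply: free_product_onel. Qed.

End FreeProduct.

Section RightQuotient.
Variables (L : monoidType) (K : Type) (f : K -> L).

(* K acts on the right of L by x.k = x * f k. *)
Definition right_orbit_equiv : L -> L -> Prop :=
  clos_refl_sym_trans L (fun x y => exists k : K, y = x * f k).

Definition right_orbit_rel : rel L := fun x y => `[< right_orbit_equiv x y >].

Lemma right_orbit_rel_refl : reflexive right_orbit_rel.
Proof. by move=> x; apply/asboolP; apply: rst_refl. Qed.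

Lemma right_orbit_rel_sym : symmetric right_orbit_rel.
Proof. by move=> x y; apply/asboolP/asboolP; apply: rst_sym. Qed.

Lemma right_orbit_rel_trans : transitive right_orbit_rel.
Proof.
move=> y x z /asboolP xy /asboolP yz; apply/asboolP.
exact: rst_trans xy yz.
Qed.

Canonical right_orbit_equiv_rel := EquivRel right_orbit_rel
  right_orbit_rel_refl right_orbit_rel_sym right_orbit_rel_trans.

Definition right_quot : Type := {eq_quot right_orbit_equiv_rel}.
HB.instance Definition _ := Choice.on right_quot.
HB.instance Definition _ := Quotient.on right_quot.
HB.instance Definition _ := EqQuotient.on right_quot.

Lemma right_quotP (x y : L) :
  \pi_right_quot x = \pi_right_quot y <-> right_orbit_equiv x y.
Proof.
split; first by move/eqquotP/asboolP.
by move=> xy; apply/eqquotP/asboolP.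
Qed.

End RightQuotient.

Section OttoPride.
(* B is the submonoid A of M, seen as a monoid in its own right. *)
Variables (M : monoidType) (A : pred M) (B : subMonoidType A).
Variable phi : UMagmaMorphism.type B M.

Local Notation base := (free_product M (free_monoid unit)).
Local Notation base_t := (free_product_inr M (letter tt) : base).
Local Notation base_of m := (free_product_inl (free_monoid unit) m : base).

Inductive otto_pride_rel : base -> base -> Prop :=
| otto_pride_relI (a : B) :
    otto_pride_rel (base_of (\val a) * base_t) (base_t * base_of (phi a)).

Definition otto_pride : monoidType := congr_quot otto_pride_rel.

Definition otto_pride_t : otto_pride := \pi_(congr_quot otto_pride_rel) base_t.

Definition otto_pride_of (m : M) : otto_pride :=
  \pi_(congr_quot otto_pride_rel) (base_of m).

Definition otto_pride_ofsub (a : B) : otto_pride := otto_pride_of (\val a).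

Lemma otto_prideE (a : B) :
  otto_pride_ofsub a * otto_pride_t = otto_pride_t * otto_pride_of (phi a).
Proof.
rewrite -[LHS]pi_congrM -[RHS]pi_congrM.
by apply/congr_quotP/congr_base; apply: otto_pride_relI.
Qed.

Local Notation otto_pride_vertex := (right_quot otto_pride_of).
Local Notation otto_pride_edge := (right_quot otto_pride_ofsub).

Definition vertex_class (x : otto_pride) : otto_pride_vertex :=
  \pi_(right_quot otto_pride_of) x.
Definition edge_class (x : otto_pride) : otto_pride_edge :=
  \pi_(right_quot otto_pride_ofsub) x.

Definition otto_pride_graph : multigraph :=
  @Multigraph otto_pride_vertex otto_pride_edge
    (fun e => vertex_class (repr e))
    (fun e => vertex_class (repr e * otto_pride_t)).

(* The endpoints do not depend on the representative x of the edge. *)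

Lemma endpoint0E (x : otto_pride) :
  @endpoint0 otto_pride_graph (edge_class x) = vertex_class x.
Proof.
suff same y z : right_orbit_equiv otto_pride_ofsub y z ->
    vertex_class y = vertex_class z.
  by apply/same/right_quotP; rewrite reprK.
elim=> {y z} [y z [a ->]|//|y z _ -> //|y z w _ -> _ -> //].
by apply/right_quotP/rst_step; exists (\val a).
Qed.

Lemma endpoint1E (x : otto_pride) :
  @endpoint1 otto_pride_graph (edge_class x) = vertex_class (x * otto_pride_t).
Proof.
suff same y z : right_orbit_equiv otto_pride_ofsub y z ->
    vertex_class (y * otto_pride_t) = vertex_class (z * otto_pride_t).
  by apply/same/right_quotP; rewrite reprK.
elim=> {y z} [y z [a ->]|//|y z _ -> //|y z w _ -> _ -> //].
by apply/right_quotP/rst_step; exists (phi a); rewrite -!mulgA otto_prideE.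
Qed.

End OttoPride.

(* Main.v *)
Require Import Defs.
From mathcomp Require Import all_boot.
From Stdlib Require Import Relation_Operators.

(** Connectedness: [M] and [t] generate [L], right multiplication by [M] fixes
    every vertex, and [x]_M, [xt]_M are the endpoints of the edge [x]_A.

    Acyclicity: for each edge [e], there is a 2-colouring of the vertices for
    which the endpoints of an edge have different colours exactly when the edge
    is [e].  A closed walk changes colour an even number of times, so it cannot
    traverse [e] exactly once.  The colouring comes from the right action of [L]
    on [L * bool] given by (x,b).m = (xm,b) and (x,b).t = (xt, b + [x]_A == e),
    where the defining relations hold because [xa]_A = [x]_A; it is the mod 2
    coefficient at [e] of the derivation [L -> ZL/A] that kills [M] and sends
    [t] to [1]_A. *)

Set Implicit Arguments.
Unset Strict Implicit.
Unset Printing Implicit Defensive.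

Local Open Scope group_scope.
Local Open Scope quotient_scope.

(** * Walks, and a colouring criterion for acyclicity *)

Section Walks.
Variable G : multigraph.
Implicit Types (x y z : vertex G) (p : seq (dart G)).

Definition walk_connected x y : Prop := exists p, is_walk x p y.

Lemma walk_connected_refl x : walk_connected x x.
Proof. by exists [::] => /=. Qed.

Lemma walk_connected_dart (d : dart G) : walk_connected (origin d) (terminus d).
Proof. by exists [:: d]; rewrite /= !eqxx. Qed.

Lemma walk_connected_trans x y z :
  walk_connected x y -> walk_connected y z -> walk_connected x z.
Proof.
case=> p; elim: p x => [|d p IHp] x /= => [/eqP-> //|/andP[/eqP<- py] yz].
have [q qz] := IHp _ py yz.
by exists (d :: q); rewrite /= eqxx.
Qed.

Lemma walk_connected_sym x y : walk_connected x y -> walk_connected y x.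
Proof.
case=> p; elim: p x => [|[e b] p IHp] x /=.
  by move=> /eqP->; apply: walk_connected_refl.
move=> /andP[/eqP<- /IHp yt]; apply: walk_connected_trans yt _.
by case: b; [apply: (walk_connected_dart (e, false))
            |apply: (walk_connected_dart (e, true))].
Qed.

Lemma no_cycle_of_edge_colouring :
  (forall e : edge G, exists c : vertex G -> bool,
     forall e', c (endpoint1 e') = c (endpoint0 e') (+) (e' == e)) ->
  forall p, ~ is_cycle p.
Proof.
move=> colouring [|d p] [// _ [x px] _]; rewrite map_cons cons_uniq.
move=> /andP[dNp _]; have [c cE] := colouring d.1.
have c_dart d' : c (terminus d') = c (origin d') (+) (d'.1 == d.1).
  by case: d' => e [] /=; rewrite cE // addbK.
have c_walk q y z : d.1 \notin [seq d'.1 | d' <- q] -> is_walk y q z -> c y = c z.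
  elim: q y => [|d' q IHq] y /=; first by move=> _ /eqP->.
  rewrite inE negb_or => /andP[dd' dNq] /andP[/eqP<- qz].
  by rewrite -(IHq _ dNq qz) c_dart eq_sym (negPf dd') addbF.
(* The first dart [d] flips the colour of [x], while the rest of the cycle avoids the edge of [d]
   and so carries the flipped colour back to [x]. *)
move: px => /= /andP[/eqP dx px]; have := c_walk _ _ _ dNp px.
by rewrite c_dart eqxx dx addbT; case: (c x).
Qed.

End Walks.

(** * Right actions descending to a congruence quotient *)

Section CongruenceQuotientAction.
Variables (G : monoidType) (R : G -> G -> Prop) (S : Type) (act : S -> G -> S).
Hypothesis actM : forall s x y, act s (x * y) = act (act s x) y.
Hypothesis actR : forall s x y, R x y -> act s x = act s y.

Definition quot_act (s : S) (q : congr_quot R) : S := act s (repr q).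

(** Acting equally on every point is a congruence by [actM] and contains [R], hence contains its
    closure. The point [s] varies in the induction because the second factor of a product acts on a
    moved point. *)
Lemma quot_act_pi s x : quot_act s (\pi_(congr_quot R) x) = act s x.
Proof.
have: congr_closure R (repr (\pi_(congr_quot R) x)) x.
  by apply/congr_quotP; rewrite reprK.
rewrite /quot_act; move: (repr _) => y xy.
elim: xy s => {x y}
  [x y /actR//|//|x y _ IH s|x y z _ IH1 _ IH2 s|x x' y y' _ IH1 _ IH2 s].
- by rewrite IH.
- by rewrite IH1.
- by rewrite !actM IH1 IH2.
Qed.

Lemma quot_actM s p q : quot_act s (p * q) = quot_act (quot_act s p) q.
Proof.
by elim/quotW: p => x; elim/quotW: q => y; rewrite -pi_congrM !quot_act_pi actM.
Qed.

End CongruenceQuotientAction.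

(** * Generators of [L] and connectedness *)

Section OttoPrideTree.
Variables (M : monoidType) (A : pred M) (B : subMonoidType A).
Variable phi : UMagmaMorphism.type B M.

Local Notation L := (otto_pride phi).
Local Notation t := (otto_pride_t phi).
Local Notation of_M := (otto_pride_of phi).
Local Notation of_A := (otto_pride_ofsub phi).

Lemma otto_pride_ofM (m m' : M) : of_M (m * m') = of_M m * of_M m'.
Proof. by rewrite /otto_pride_of free_product_inlM pi_congrM. Qed.

Lemma otto_pride_of1 : of_M 1 = 1.
Proof. by rewrite /otto_pride_of free_product_inl1. Qed.

Lemma otto_pride_ind (P : L -> Prop) :
  P 1 -> (forall x y, P x -> P y -> P (x * y)) ->
  (forall m, P (of_M m)) -> P t -> forall x, P x.
Proof.
move=> P1 PM Pof Pt; elim/quotW; elim/quotW=> w.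
pose pi w := \pi_(congr_quot (otto_pride_rel phi))
  (\pi_(congr_quot (@free_product_rel M (free_monoid unit))) w) : L.
have piM w1 w2 : pi (w1 * w2) = pi w1 * pi w2 by rewrite /pi !pi_congrM.
rewrite -/(pi w); elim: w => [|l w IHw]; first exact: P1.
rewrite (piM [:: l] w); apply: (PM _ _) => // {w IHw}.
case: l => [m|n]; first exact: Pof.
(* A letter [inr n] stands for the power of [t] with exponent [size n]; one factor [t] is split off
   at a time. *)
elim: n => [|[] n IHn].
  rewrite (_ : pi _ = 1) //; congr (\pi _).
  by apply/congr_quotP/congr_base; apply: free_product_oner.
rewrite (_ : pi _ = t * pi (letter (inr n))); first exact: PM.
rewrite -[RHS]piM; congr (\pi _).
by apply/congr_quotP/congr_sym/congr_base; apply: (free_product_mulr _ (letter tt)).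
Qed.

Lemma vertex_class_mulr_of (x : L) (m : M) :
  vertex_class (x * of_M m) = vertex_class x.
Proof. by apply/right_quotP/rst_sym/rst_step; exists m. Qed.

Lemma edge_class_mulr_ofsub (x : L) (a : B) :
  edge_class (x * of_A a) = edge_class x.
Proof. by apply/right_quotP/rst_sym/rst_step; exists a. Qed.

Lemma otto_pride_connected : is_connected (otto_pride_graph phi).
Proof.
split=> [|u v]; first exact: (inhabits (vertex_class (1 : L))).
(* The start [y] is arbitrary, so that a walk from [y] to [y * x] can be followed by one from there
   to [y * x * x']. *)
have conn1 (x y : L) :
    @walk_connected (otto_pride_graph phi) (vertex_class y) (vertex_class (y * x)).
  elim/otto_pride_ind: x y => [y|x x' IHx IHx' y|m y|y].
  - by rewrite mulg1; apply: walk_connected_refl.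
  - by rewrite mulgA; apply: walk_connected_trans (IHx y) (IHx' _).
  - by rewrite vertex_class_mulr_of; apply: walk_connected_refl.
  - have := walk_connected_dart (edge_class y : edge (otto_pride_graph phi), true).
    by rewrite /origin /terminus [_.1]/= endpoint0E endpoint1E.
elim/quotW: u => x; elim/quotW: v => y.
apply: (@walk_connected_trans (otto_pride_graph phi) _ (vertex_class (1 : L))).
  by apply: walk_connected_sym; have := conn1 x 1; rewrite mul1g.
by have := conn1 y 1; rewrite mul1g.
Qed.

(** * The action of [L] on [L * bool] and the colouring attached to [e] *)

Section Colouring.
Variable e : edge (otto_pride_graph phi).

Definition t_step (s : L * bool) : L * bool :=
  (s.1 * t, s.2 (+) (edge_class s.1 == e)).

Definition letter_step (s : L * bool) (l : M + free_monoid unit) : L * bool :=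
  match l with
  | inl m => (s.1 * of_M m, s.2)
  | inr n => iter (size n) t_step s
  end.

Definition word_act (s : L * bool) (w : free_monoid (M + free_monoid unit)) :=
  foldl letter_step s w.

Lemma word_actM s w w' : word_act s (w * w') = word_act (word_act s w) w'.
Proof. exact: foldl_cat. Qed.

Lemma word_act_rel s w w' :
  free_product_rel w w' -> word_act s w = word_act s w'.
Proof.
case=> [m m'||n n'|] //=; rewrite /word_act /=.
- by rewrite otto_pride_ofM mulgA.
- by rewrite otto_pride_of1 mulg1; case: s.
(* The word [n] acts first, but [iterD] applies its second summand first. *)
- by rewrite size_cat addnC iterD.
Qed.

(** [L] is an iterated quotient, so the action descends from words to the free product and then to
    [L]. *)
Definition free_act := quot_act (R := @free_product_rel M (free_monoid unit)) word_act.

Lemma free_actM s x y : free_act s (x * y) = free_act (free_act s x) y.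
Proof. exact: quot_actM word_actM word_act_rel s x y. Qed.

Lemma free_act_rel s x y : otto_pride_rel phi x y -> free_act s x = free_act s y.
Proof.
case=> a; rewrite !free_actM /free_act !(quot_act_pi word_actM word_act_rel).
rewrite /word_act /= /t_step /= -!mulgA -otto_prideE.
by rewrite (edge_class_mulr_ofsub s.1 a).
Qed.

Definition otto_pride_act := quot_act (R := otto_pride_rel phi) free_act.

Lemma otto_pride_actM s x y :
  otto_pride_act s (x * y) = otto_pride_act (otto_pride_act s x) y.
Proof. exact: quot_actM free_actM free_act_rel s x y. Qed.

Lemma otto_pride_act_of s m : otto_pride_act s (of_M m) = (s.1 * of_M m, s.2).
Proof.
rewrite /otto_pride_act (quot_act_pi free_actM free_act_rel).
by rewrite /free_act (quot_act_pi word_actM word_act_rel).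
Qed.

Lemma otto_pride_act_t s : otto_pride_act s t = t_step s.
Proof.
rewrite /otto_pride_act (quot_act_pi free_actM free_act_rel).
by rewrite /free_act (quot_act_pi word_actM word_act_rel).
Qed.

(** This ensures that a [t] acting after [x] on [(1, false)] tests the edge [[x]_A] against [e]. *)
Lemma otto_pride_act_fst s x : (otto_pride_act s x).1 = s.1 * x.
Proof.
elim/otto_pride_ind: x s => [s|x y IHx IHy s|m s|s].
- by rewrite -otto_pride_of1 otto_pride_act_of.
- by rewrite otto_pride_actM IHy IHx mulgA.
- by rewrite otto_pride_act_of.
- by rewrite otto_pride_act_t.
Qed.

(** The parity of the number of traversals of [e] along any walk from [[1]_M] to [[x]_M]. *)
Definition colour (x : L) : bool := (otto_pride_act (1, false) x).2.

Lemma colour_of x m : colour (x * of_M m) = colour x.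
Proof. by rewrite /colour otto_pride_actM otto_pride_act_of. Qed.

Lemma colour_t x : colour (x * t) = colour x (+) (edge_class x == e).
Proof.
by rewrite /colour otto_pride_actM otto_pride_act_t /= otto_pride_act_fst mul1g.
Qed.

(** By [colour_of] the colour is constant along the steps generating the orbit relation, so it
    descends to [L/M]. *)
Lemma colour_repr_vertex x : colour (repr (vertex_class x)) = colour x.
Proof.
have: right_orbit_equiv of_M (repr (vertex_class x)) x.
  by apply/right_quotP; rewrite reprK.
move: (repr _) => y.
by elim=> {x y} [x y [m ->]|//|x y _ -> //|x y z _ -> _ -> //]; rewrite colour_of.
Qed.

End Colouring.

Lemma otto_pride_acyclic p : ~ @is_cycle (otto_pride_graph phi) p.
Proof.
apply: no_cycle_of_edge_colouring => e.
exists (fun v => colour e (repr v)); elim/quotW=> x.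
rewrite -[\pi x]/(edge_class x) endpoint0E endpoint1E.
by rewrite !colour_repr_vertex colour_t.
Qed.

End OttoPrideTree.

Theorem lemma5p5 (M : monoidType) (A : pred M) (B : subMonoidType A)
    (phi : UMagmaMorphism.type B M) :
  is_tree (otto_pride_graph phi).
Proof. by split; [apply: otto_pride_connected | apply: otto_pride_acyclic]. Qed.
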